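(* Let $N\ge 1$ and let $((Y(t),X(t));t\ge 0)$ be a Markov process in $\mathbb{W}^{N,N+1}$ with semigroup $(\mathfrak{U}_t^{N,N+1};t\ge 0)$. Let $\mathfrak{M}^{N+1}$ be a probability measure on $\mathbb{W}^{N+1}$, and assume that $((Y(t),X(t));t\ge 0)$ is initialized according to the probability measure on $\mathbb{W}^{N,N+1}$ with density $\mathfrak{M}^{N+1}(x)\,\mathfrak{L}_N^{N+1}(x,y)$ at $(y,x)$. Then the projection $(X(t);t\ge0)$ on the $X$-particles is distributed as a Markov process with semigroup $(\mathfrak{P}_t^{N+1};t\ge 0)$ and initial condition $\mathfrak{M}^{N+1}$. Moreover, for any fixed time $T\ge 0$, the conditional distribution of $(X(T),Y(T))$ given $X(T)$ is $$\mathsf{Law}\left[(X(T),Y(T))\,\big|\,X(T)\right]=\mathfrak{L}_N^{N+1}(X(T),\cdot).$$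
   Context: $\mathbb{Z}_+=\{0,1,2,\dots\}$ and $\lambda:\mathbb{Z}_+\to(0,\infty)$ satisfies $0<\inf\lambda\le\sup\lambda<\infty$. Let $[\nabla^+f](x)=f(x+1)-f(x)$, $[\nabla^-f](x)=f(x-1)-f(x)$ (a subscript indicates the variable acted on), and let $\mathsf{L}=\lambda(x)\nabla^+_x$ be the generator of the pure-birth chain on $\mathbb{Z}_+$ jumping from $x$ to $x+1$ at rate $\lambda(x)$; $e^{t\mathsf{L}}(x,y)$ is its transition probability from $x$ to $y$ in time $t$, and $e^{t\mathsf{L}}\mathbf{1}_{[\![0,y]\!]}(x)=\sum_{z=0}^{y}e^{t\mathsf{L}}(x,z)$ (equal to $0$ if $y=-1$). $\mathbb{W}^N=\{x\in\mathbb{Z}_+^N:x_1<\dots<x_N\}$; for $y\in\mathbb{W}^N,x\in\mathbb{W}^{N+1}$, $y\prec x$ means $x_1\le y_1<x_2\le\dots<x_N\le y_N<x_{N+1}$; $\mathbb{W}^{N,N+1}=\{(y,x)\in\mathbb{Z}_+^{N}\times\mathbb{Z}_+^{N+1}:x_1\le y_1<x_2\le\dots\le y_N<x_{N+1}\}$. Functions $\mathfrak{h}_N$ on $\mathbb{W}^N$: $\mathfrak{h}_1\equiv 1$, $\mathfrak{h}_{N+1}(x)=\sum_{y\in\mathbb{W}^N,\,y\prec x}\prod_{i=1}^N\lambda(y_i)^{-1}\,\mathfrak{h}_N(y)$. They are strictly positive. Two-level kernel: for $(y,x),(y',x')\in\mathbb{W}^{N,N+1}$, $$\mathsf{U}_t^{N,N+1}[(y,x),(y',x')]=\det\begin{pmatrix}\mathsf{A}_t(x,x')&\mathsf{B}_t(x,y')\\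 \mathsf{C}_t(y,x')&\mathsf{D}_t(y,y')\end{pmatrix},$$ a determinant of size $2N+1$ with blocks of sizes $(N+1)\times(N+1)$, $(N+1)\times N$, $N\times(N+1)$, $N\times N$ and entries $\mathsf{A}_t(x,x')_{ij}=e^{t\mathsf{L}}(x_i,x'_j)$; $\mathsf{B}_t(x,y')_{ij}=\lambda(y'_j)^{-1}\big(e^{t\mathsf{L}}\mathbf{1}_{[\![0,y'_j]\!]}(x_i)-\mathbf{1}(j\ge i)\big)$; $\mathsf{C}_t(y,x')_{ij}=\lambda(y_i)\nabla^+_{y_i}\nabla^-_{x'_j}e^{t\mathsf{L}}\mathbf{1}_{[\![0,x'_j]\!]}(y_i)$; $\mathsf{D}_t(y,y')_{ij}=e^{t\mathsf{L}}(y_i,y'_j)$. Doob transforms (these are Markov kernels/semigroups): $$\mathfrak{L}_N^{N+1}(x,y)=\frac{\mathfrak{h}_N(y)}{\mathfrak{h}_{N+1}(x)}\prod_{i=1}^N\frac{1}{\lambda(y_i)}\mathbf{1}(y\prec x),\quad x\in\mathbb{W}^{N+1},y\in\mathbb{W}^N,$$ $$\mathfrak{P}_t^N(x,y)=\frac{\mathfrak{h}_N(y)}{\mathfrak{h}_N(x)}\det\big(e^{t\mathsf{L}}(x_i,y_j)\big)_{i,j=1}^N,\quad x,y\in\mathbb{W}^N,$$ $$\mathfrak{U}_t^{N,N+1}[(y,x),(y',x')]=\frac{\mathfrak{h}_N(y')}{\mathfrak{h}_N(y)}\mathsf{U}_t^{N,N+1}[(y,x),(y',x')].$$ $\mathfrak{L}_N^{N+1}$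 is also viewed as a Markov kernel from $\mathbb{W}^{N+1}$ to $\mathbb{W}^{N,N+1}$: $\mathfrak{L}_N^{N+1}(x,\cdot)$ is supported on pairs $(y,z)\in\mathbb{W}^{N,N+1}$ with $z=x$ and gives $(y,x)$ mass $\mathfrak{L}_N^{N+1}(x,y)$. *)

(* Defs.v *)
From HB Require Import structures.
From mathcomp Require Import all_boot all_order all_algebra.
From mathcomp Require Import all_classical all_reals all_analysis.

Set Implicit Arguments.
Unset Strict Implicit.
Unset Printing Implicit Defensive.

Import Order.TTheory GRing.Theory Num.Theory.
Import numFieldNormedType.Exports.

Local Open Scope classical_set_scope.
Local Open Scope ring_scope.

(** * State spaces

  Particle indices run over ['I_N], i.e. they start at 0. *)

Definition is_weyl N (x : {ffun 'I_N -> nat}) : bool :=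
  [forall i : 'I_N, forall j : 'I_N, (i < j)%N ==> (x i < x j)%N].

Definition weyl (N : nat) : Type := {x : {ffun 'I_N -> nat} | is_weyl x}.

(* x_1 <= y_1 < x_2 <= y_2 < ... <= y_N < x_{N+1} *)
Definition interlaced N (y : {ffun 'I_N -> nat})
    (x : {ffun 'I_N.+1 -> nat}) : bool :=
  [forall i : 'I_N, (x (widen_ord (leqnSn N) i) <= y i < x (lift ord0 i))%N].

Definition weyl2 (N : nat) : Type :=
  {p : {ffun 'I_N -> nat} * {ffun 'I_N.+1 -> nat} | interlaced p.1 p.2}.

Lemma is_weyl_step N (x : {ffun 'I_N -> nat}) :
  (forall i j : 'I_N, val j = (val i).+1 -> (x i < x j)%N) -> is_weyl x.
Proof.
move=> xS; apply/forallP => i; apply/forallP => -[j ltjN]; apply/implyP => /=.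
elim: j ltjN => // j IHj ltjN; rewrite ltnS leq_eqVlt => /orP[/eqP ij|ltij].
  by apply: xS; rewrite /= ij.
apply: leq_trans (IHj (ltnW ltjN) ltij) _.
by apply/ltnW/xS.
Qed.

Lemma weyl2_upper N (p : weyl2 N) : is_weyl (val p).2.
Proof.
apply: is_weyl_step => i j jSi.
have ltiN : (i < N)%N by have := ltn_ord j; rewrite jSi ltnS.
have /forallP/(_ (Ordinal ltiN))/andP[h1 h2] := valP p.
have ei : widen_ord (leqnSn N) (Ordinal ltiN) = i by apply: val_inj.
have ej : lift ord0 (Ordinal ltiN) = j by apply: val_inj; rewrite jSi.
by rewrite -ei -ej; apply: leq_ltn_trans h1 h2.
Qed.

Lemma weyl2_lower N (p : weyl2 N) : is_weyl (val p).1.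
Proof.
apply: is_weyl_step => i j jSi.
have /forallP hp := valP p.
have /andP[_ h1] := hp i; have /andP[h2 _] := hp j.
apply: leq_trans h1 _; apply: leq_trans h2.
by rewrite (_ : lift ord0 i = widen_ord (leqnSn N) j) //; apply: val_inj.
Qed.

Definition ypart N (p : weyl2 N) : weyl N :=
  exist (fun x => is_true (is_weyl x)) _ (weyl2_lower p).
Definition xpart N (p : weyl2 N) : weyl N.+1 :=
  exist (fun x => is_true (is_weyl x)) _ (weyl2_upper p).

Lemma is_weyl_iota N : is_weyl [ffun i : 'I_N => val i].
Proof. by apply: is_weyl_step => i j; rewrite !ffunE => ->. Qed.

Lemma interlaced_iota N :
  interlaced [ffun i : 'I_N => val i] [ffun i : 'I_N.+1 => val i].
Proof. by apply/forallP => i; rewrite !ffunE /= leqnn /bump /= ltnS leqnn. Qed.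

(* Both (countable) state spaces carry the discrete sigma-algebra. *)

HB.instance Definition _ N := Countable.on (weyl N).
HB.instance Definition _ N := isPointed.Build (weyl N)
  (exist (fun x => is_true (is_weyl x)) _ (is_weyl_iota N)).
HB.instance Definition _ N := @isMeasurable.Build default_measure_display
  (weyl N) discrete_measurable discrete_measurable0
  discrete_measurableC discrete_measurableU.

HB.instance Definition _ N := Countable.on (weyl2 N).
HB.instance Definition _ N := isPointed.Build (weyl2 N)
  (exist (fun p : {ffun 'I_N -> nat} * {ffun 'I_N.+1 -> nat} =>
    is_true (interlaced p.1 p.2)) (_, _) (interlaced_iota N)).
HB.instance Definition _ N := @isMeasurable.Build default_measure_display
  (weyl2 N) discrete_measurable discrete_measurable0
  discrete_measurableC discrete_measurableU.

Section kernels.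
Context {R : realType}.
Implicit Types (lam : nat -> R) (t : R).

Definition nablap (f : nat -> R) (x : nat) : R := f x.+1 - f x.

(* Functions of the variable y of 1_[[0, y]] are indexed by [int], so that
   nabla^- may evaluate them at y = -1. *)
Definition nablam (f : int -> R) (x : int) : R := f (x - 1) - f x.

(** * The pure-birth semigroup *)

Definition genL lam (f : nat -> R) (x : nat) : R := lam x * nablap f x.

(* Since lam is bounded, L is a bounded operator on bounded functions, and
   e^{tL} is given by the exponential series. *)
Definition expL lam t (f : nat -> R) (x : nat) : R :=
  limn (series (fun n => t ^+ n / n`!%:R * iter n (genL lam) f x)).

Definition ptrans lam t (x y : nat) : R :=
  expL lam t (fun z => (z == y)%:R) x.

(* e^{tL} 1_[[0, y]] (x), which vanishes for y = -1 *)
Definition pcum lam t (y : int) (x : nat) : R :=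
  if y is Posz n then \sum_(0 <= z < n.+1) ptrans lam t x z else 0.

(** * The functions h_N

  [hfun lam 0] is a dummy value. *)

Fixpoint hfun lam (N : nat) : weyl N -> R :=
  match N return weyl N -> R with
  | 0 => fun=> 1
  | N'.+1 => fun x =>
      if N' == 0%N then 1 else
      \sum_(y \in [set y : weyl N' | interlaced (val y) (val x)])
        ((\prod_i (lam (val y i))^-1) * hfun lam y)
  end.

(** * The kernels *)

Definition blockA lam t N (x x' : {ffun 'I_N.+1 -> nat}) : 'M[R]_N.+1 :=
  \matrix_(i, j) ptrans lam t (x i) (x' j).

Definition blockB lam t N (x : {ffun 'I_N.+1 -> nat})
    (y' : {ffun 'I_N -> nat}) : 'M[R]_(N.+1, N) :=
  \matrix_(i, j) ((lam (y' j))^-1 *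
    (pcum lam t (y' j)%:Z (x i) - (i <= j)%N%:R)).

Definition blockC lam t N (y : {ffun 'I_N -> nat})
    (x' : {ffun 'I_N.+1 -> nat}) : 'M[R]_(N, N.+1) :=
  \matrix_(i, j) (lam (y i) *
    nablap (fun v => nablam (fun u => pcum lam t u v) (x' j)%:Z) (y i)).

Definition blockD lam t N (y y' : {ffun 'I_N -> nat}) : 'M[R]_N :=
  \matrix_(i, j) ptrans lam t (y i) (y' j).

Definition Uker lam t N (p q : weyl2 N) : R :=
  let: (y, x) := val p in let: (y', x') := val q in
  \det (block_mx (blockA lam t x x') (blockB lam t x y')
                 (blockC lam t y x') (blockD lam t y y')).

Definition LDoob lam N (x : weyl N.+1) (y : weyl N) : R :=
  hfun lam y / hfun lam x * (\prod_i (lam (val y i))^-1) *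
  (interlaced (val y) (val x))%:R.

(* [LDoob] viewed as a kernel from W^{N+1} to W^{N,N+1} *)
Definition LDoob2 lam N (x : weyl N.+1) (q : weyl2 N) : R :=
  (xpart q == x)%:R * LDoob lam x (ypart q).

Definition PDoob lam N t (x y : weyl N) : R :=
  hfun lam y / hfun lam x *
  \det (\matrix_(i < N, j < N) ptrans lam t (val x i) (val y j)).

Definition UDoob lam N t (p q : weyl2 N) : R :=
  hfun lam (ypart q) / hfun lam (ypart p) * Uker lam t p q.

End kernels.

(** * Conditional laws and Markov processes *)

Section markov.
Context {d : measure_display} {Omega : measurableType d} {R : realType}.
Variable P : probability Omega R.

(* [f] is a version of the conditional probability P(E | G), for [G] a
   sub-sigma-algebra. *)
Definition is_cond_prob (G : set_system Omega) (E : set Omega)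
    (f : Omega -> R) : Prop :=
  [/\ forall B : set R, measurable B -> G (f @^-1` B),
      P.-integrable setT (EFin \o f) &
      forall A, G A -> (\int[P]_(w in A) (f w)%:E = P (A `&` E))%E].

(* Law[Z | G] = kappa, where [Z] takes values in a countable discrete space
   and [kappa w] is a (random) probability mass function on it. *)
Definition is_cond_law (S : Type) (G : set_system Omega) (Z : Omega -> S)
    (kappa : Omega -> S -> R) : Prop :=
  forall z : S, is_cond_prob G (Z @^-1` [set z]) (fun w => kappa w z).

Definition sigma_rv d' (S : measurableType d') (Z : Omega -> S) :
    set_system Omega :=
  preimage_set_system setT Z measurable.

Definition natural_filtration d' (S : measurableType d')
    (Z : {nonneg R} -> Omega -> S) (s : {nonneg R}) : set_system Omega :=
  <<s \bigcup_(u in [set u : {nonneg R} | u%:num <= s%:num])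
        sigma_rv (Z u) >>.

(* Time-homogeneous Markov process with transition probabilities
   K t z z' on a countable discrete state space. *)
Definition markov_process d' (S : measurableType d')
    (K : R -> S -> S -> R) (Z : {nonneg R} -> Omega -> S) : Prop :=
  (forall t, measurable_fun setT (Z t)) /\
  forall s t : {nonneg R}, s%:num <= t%:num ->
    is_cond_law (natural_filtration Z s) (Z t)
      (fun w => K (t%:num - s%:num) (Z s w)).

End markov.

(* Main.v *)
(** The law of [X] follows from the intertwining [L U_t = P_t L] of Markov
  kernels.  The [i]-th lower row of the determinant [U_t[(y, x), .]] depends on
  [y_i] only, and the [y_i] with [y] below [x] range independently over
  [[x_i, x_(i+1) - 1]]; so the sum over [y] with weights [1 / lam(y_i)] can be
  taken row by row.  It telescopes, because
  [lam(v) nabla^+ e^{tL} 1_[[0, n]] (v) = - lam(n) e^{tL}(v, n)], and turns each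
  lower row into the difference of two consecutive upper rows plus a diagonal
  entry.  Row operations then leave a block triangular determinant.

  Given the intertwining (Rogers and Pitman), consider the events [A] of the
  past of [Z] at time [s] on which, for every [x], [Y(s)] has law [L(x, .)]
  when [X(s) = x].  They keep this property at later times and after
  intersection with events [X(s) \in V], so all cylinder events of [X] up to
  time [s] have it, and by the pi-lambda theorem all events of the past of [X].
*)
Require Import Defs.
From HB Require Import structures.
From mathcomp Require Import all_boot all_order all_algebra.
From mathcomp Require Import all_classical all_reals all_analysis.
From mathcomp Require Import perm measurable_realfun ring.

Set Implicit Arguments.
Unset Strict Implicit.
Unset Printing Implicit Defensive.

Import Order.TTheory GRing.Theory Num.Theory.
Import numFieldNormedType.Exports.

Local Open Scope classical_set_scope.
Local Open Scope ring_scope.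

(** * The pure-birth semigroup *)

Section pure_birth.
Context {R : realType} (lam : nat -> R) (K : R).
Hypothesis lam_le : forall x, `|lam x| <= K.
Implicit Types (t : R) (f g : nat -> R).

Definition bounded_by (M : R) f := forall x, `|f x| <= M.

Lemma iter_genL_le M f n : bounded_by M f ->
  bounded_by ((K * 2) ^+ n * M) (iter n (genL lam) f).
Proof.
move=> fM; elim: n => [|n IHn] x /=; first by rewrite expr0 mul1r.
rewrite /genL /nablap normrM exprS -!mulrA ler_pM// mulr2n mulrDl !mul1r.
by apply: le_trans (ler_normB _ _) _; apply: lerD; apply: IHn.
Qed.

Lemma iter_genLD n f g x : iter n (genL lam) (f \+ g) x =
  iter n (genL lam) f x + iter n (genL lam) g x.
Proof.
elim: n x => [//|n IHn] x /=; rewrite /genL /nablap !IHn; ring.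
Qed.

Lemma iter_genLZ n a f x : iter n (genL lam) (a \*o f) x =
  a * iter n (genL lam) f x.
Proof.
elim: n x => [//|n IHn] x /=; rewrite /genL /nablap !IHn; ring.
Qed.

(** On bounded functions [genL lam] has norm at most [K * 2], so the series is dominated by [M]
    times the exponential series at [|t| * (K * 2)]. *)
Lemma is_cvg_expL t M f x : bounded_by M f ->
  cvgn (series (fun n => t ^+ n / n`!%:R * iter n (genL lam) f x)).
Proof.
move=> fM; apply: normed_cvg.
have M0 : 0 <= M := le_trans (normr_ge0 _) (fM 0%N).
have K0 : 0 <= K := le_trans (normr_ge0 _) (lam_le 0%N).
apply: (@series_le_cvg _ _ (fun n => M * exp_coeff (`|t| * (K * 2)) n))
  => [n|n|n|].
- exact: normr_ge0.
- by rewrite /exp_coeff/= !mulr_ge0 ?invr_ge0 ?exprn_ge0// !mulr_ge0.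
- rewrite /exp_coeff /= normrM normrM normrX normfV normr_nat exprMn.
  have := iter_genL_le n fM x => h.
  rewrite [leRHS](_ : _ = `|t| ^+ n / n`!%:R * ((K * 2) ^+ n * M)); last first.
    by ring.
  by rewrite ler_wpM2l// mulr_ge0 ?invr_ge0 ?exprn_ge0.
- rewrite -[fun n => _]/(M *: exp_coeff _).
  exact/is_cvg_seriesZ/is_cvg_series_exp_coeff.
Qed.

Lemma expLD t M M' f g x : bounded_by M f -> bounded_by M' g ->
  expL lam t (f \+ g) x = expL lam t f x + expL lam t g x.
Proof.
move=> fM gM; rewrite /expL -lim_seriesD; [|exact: is_cvg_expL..].
by congr (limn (series _)); apply/funext => n; rewrite /= iter_genLD mulrDr.
Qed.

Lemma expLZ t M a f x : bounded_by M f ->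
  expL lam t (a \*o f) x = a * expL lam t f x.
Proof.
move=> fM; rewrite /expL -[RHS]lim_seriesZ; last exact: is_cvg_expL.
congr (limn (series _)); apply/funext => n.
by rewrite iter_genLZ /= mulrCA.
Qed.

(** [genL lam] only combines the values at [x] and [x.+1], so it can be applied term by term, and it
    commutes with its own iterates. *)
Lemma genL_expL t M f x : bounded_by M f ->
  genL lam (expL lam t f) x = expL lam t (genL lam f) x.
Proof.
move=> fM; rewrite {1}/genL /nablap /expL.
have cf y := @is_cvg_expL t M f y fM.
rewrite -lim_seriesB// -[LHS]lim_seriesZ; last exact: is_cvg_seriesB.
congr (limn (series _)); apply/funext => n.
by rewrite -iterSr iterS [RHS]mulrCA mulrBr.
Qed.

Lemma bounded_indic (P : pred nat) : bounded_by 1 (fun z => (P z)%:R).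
Proof. by move=> x; case: (P x); rewrite ?normr1 ?normr0. Qed.

Lemma pcumE t n x :
  pcum lam t (Posz n) x = expL lam t (fun z => (z <= n)%N%:R) x.
Proof.
rewrite /pcum; elim: n => [|n IHn].
  rewrite big_nat1 /ptrans; congr expL; apply/funext => z.
  by rewrite leqn0.
rewrite big_nat_recr//= IHn /ptrans -(@expLD _ 1 1); [|exact: bounded_indic..].
congr expL; apply/funext => z /=; rewrite [in RHS]leq_eqVlt ltnS.
by case: eqVneq => [->|_]; rewrite ?ltnn ?add0r ?addr0//=.
Qed.

Lemma genL_indic_le n : genL lam (fun z => (z <= n)%N%:R) =
  (- lam n) \*o (fun z => (z == n)%:R).
Proof.
apply/funext => z; rewrite /genL /nablap /=.
by case: ltngtP => [_|_|->]; rewrite ?subrr ?mulr0 ?sub0r ?mulrN// mulNr.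
Qed.

(* Since [L 1_[[0, n]] = - lam n 1_{n}] and [L] commutes with [e^{tL}]. *)
Lemma nablap_pcum t n x :
  lam x * nablap (pcum lam t (Posz n)) x = - (lam n * ptrans lam t x n).
Proof.
have -> : pcum lam t (Posz n) = expL lam t (fun z => (z <= n)%N%:R).
  by apply/funext => y; rewrite pcumE.
rewrite -/(genL _ _ _) (@genL_expL t 1 _ x (bounded_indic _)) genL_indic_le.
by rewrite (@expLZ t 1 _ _ x (bounded_indic _)) mulNr.
Qed.

Lemma nablam_pcum t (n : nat) x :
  nablam (fun u => pcum lam t u x) n%:Z = - ptrans lam t x n.
Proof.
rewrite /nablam; case: n => [|n].
  (* The left neighbour of 0 is -1, that is [Negz 0], where [pcum] takes its default value 0. *)
  by rewrite (_ : Posz 0 - 1 = Negz 0)//= big_nat1 sub0r.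
rewrite (_ : Posz n.+1 - 1 = Posz n); last by rewrite -addn1 PoszD addrK.
by rewrite /pcum [X in _ - X]big_nat_recr//= opprD addrA subrr add0r.
Qed.

End pure_birth.

(** * Sums over interlaced configurations *)

(** Multilinearity in the lower rows, when each has its own summation index. In the Leibniz
    expansion, for each permutation, the product over lower rows of sums distributes into a sum over
    the families [f] with [f i] in [Q i]. *)
Lemma det_col_mx_sum (R : comNzRingType) (T : finType) m n
    (U : 'M[R]_(m, m + n)) (Q : 'I_n -> pred T) (c : T -> R)
    (r : T -> 'rV[R]_(m + n)) :
  \sum_(f in family Q) (\prod_i c (f i)) *
     \det (col_mx U (\matrix_(i, j) r (f i) 0 j)) =
  \det (col_mx U (\matrix_(i, j) \sum_(v | Q i v) c v * r v 0 j)).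
Proof.
rewrite /determinant.
under eq_bigr do rewrite big_distrr.
rewrite exchange_big/=; apply: eq_bigr => s _.
have split_prod (V : 'M[R]_(n, m + n)) : \prod_i col_mx U V i (s i) =
    (\prod_i U i (s (lshift n i))) * \prod_i V i (s (rshift m i)).
  rewrite big_split_ord/=; congr (_ * _); apply: eq_bigr => i _.
    by rewrite col_mxEu.
  by rewrite col_mxEd.
under eq_bigr do rewrite split_prod mulrCA.
rewrite split_prod -big_distrr; congr (_ * _).
under eq_bigr do rewrite mulrCA -big_split/=.
rewrite -big_distrr; congr (_ * _) => /=.
under [RHS]eq_bigr do rewrite mxE.
rewrite bigA_distr_big_dep/=; apply: eq_bigr => f _.
by apply: eq_bigr => i _; rewrite mxE.
Qed.

Lemma det_block_row_op (R : comUnitRingType) m n (A : 'M[R]_m)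
    (B : 'M[R]_(m, n)) (E : 'M[R]_(n, m)) (D : 'M[R]_n) :
  \det (block_mx A B (E *m A) (E *m B + D)) = \det A * \det D.
Proof.
rewrite (_ : block_mx _ _ _ _ = block_mx 1%:M 0 E 1%:M *m block_mx A B 0 D).
  by rewrite det_mulmx det_lblock det_ublock !det1 !mul1r.
by rewrite mulmx_block !mul1mx !mul0mx !addr0.
Qed.

Lemma telescope_sum_ord (R : zmodType) m a b (g : nat -> R) :
  (a <= b)%N -> (b <= m)%N ->
  \sum_(v < m | (a <= v < b)%N) (g v.+1 - g v) = g b - g a.
Proof.
move=> ab bm; rewrite -(telescope_sumr _ ab).
rewrite [RHS](big_nat_widen _ _ _ _ _ bm) [RHS](big_nat_widenl _ 0%N)//=.
by rewrite big_mkord; apply: eq_bigl => v; rewrite andbC.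
Qed.

Section interlacing.
Context {N : nat}.

(** For [x] in the Weyl chamber, an interlaced [y] has all its entries below the largest entry of
    [x]. Values in ['I_(x ord_max)] thus lose nothing, and they make the range a finite product of
    intervals, one for each entry. *)
Definition interlaced_ffuns (x : {ffun 'I_N.+1 -> nat}) :=
  family (fun (i : 'I_N) (v : 'I_(x ord_max)) =>
    (x (widen_ord (leqnSn N) i) <= v < x (lift ord0 i))%N).

Lemma interlaced_is_weyl (y : {ffun 'I_N -> nat}) x :
  interlaced y x -> is_weyl y.
Proof.
move=> yx; exact: (@weyl2_lower N
  (exist (fun p : _ * _ => is_true (interlaced p.1 p.2)) (y, x) yx)).
Qed.

Lemma weyl_lt_step (x : weyl N.+1) (i : 'I_N) :
  (val x (widen_ord (leqnSn N) i) < val x (lift ord0 i))%N.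
Proof.
have /forallP/(_ (widen_ord (leqnSn N) i))/forallP := valP x.
by move=> /(_ (lift ord0 i))/implyP; apply; rewrite /= /bump.
Qed.

Lemma weyl_le_max (x : weyl N.+1) i : (val x i <= val x ord_max)%N.
Proof.
have [->//|im] := eqVneq i ord_max.
have /forallP/(_ i)/forallP/(_ ord_max)/implyP h := valP x.
apply/ltnW/h; rewrite /= ltn_neqAle -ltnS ltn_ord andbT.
by apply: contra im => /eqP im; apply/eqP/val_inj.
Qed.

Definition weyl_of_ffun m (f : {ffun 'I_N -> 'I_m}) : weyl N :=
  insubd (point : weyl N) [ffun i => val (f i)].

Lemma val_weyl_of_ffun (x : {ffun 'I_N.+1 -> nat})
    (f : {ffun 'I_N -> 'I_(x ord_max)}) :
  f \in interlaced_ffuns x -> val (weyl_of_ffun f) = [ffun i => val (f i)].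
Proof.
move=> /familyP h; rewrite insubdK//; apply: (@interlaced_is_weyl _ x).
by apply/forallP => i; rewrite ffunE; exact: h.
Qed.

Lemma bij_interlaced (x : weyl N.+1) :
  set_bij [set` interlaced_ffuns (val x)]
    [set y : weyl N | interlaced (val y) (val x)]
    (@weyl_of_ffun (val x ord_max)).
Proof.
split.
- move=> f /= fx; rewrite val_weyl_of_ffun//.
  by apply/forallP => i; rewrite ffunE; move/familyP: fx; exact.
- move=> f g /set_mem/= fx /set_mem/= gx /(congr1 val).
  rewrite !val_weyl_of_ffun// => /ffunP fg.
  by apply/ffunP => i; apply/val_inj; have := fg i; rewrite !ffunE.
- move=> y /= /forallP yx.
  have ym i : (val y i < val x ord_max)%N.
    by have /andP[_ h] := yx i; apply: leq_trans h (weyl_le_max _ _).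
  exists [ffun i => Ordinal (ym i)].
    by apply/familyP => i; rewrite ffunE; exact: yx.
  rewrite /weyl_of_ffun [X in insubd _ X](_ : _ = val y) ?valKd//.
  by apply/ffunP => i; rewrite !ffunE.
Qed.

Lemma fsbig_interlaced (R : nmodType) (x : weyl N.+1)
    (F : {ffun 'I_N -> nat} -> R) :
  \sum_(y \in [set y : weyl N | interlaced (val y) (val x)]) F (val y) =
  \sum_(f in interlaced_ffuns (val x)) F [ffun i => val (f i)].
Proof.
rewrite (reindex_fsbig _ _ _ _ (bij_interlaced x)).
rewrite -(@bigfs _ _ _ _ (index_enum _)) ?index_enum_uniq//; last first.
  by move=> f _; rewrite mem_index_enum.
by apply: eq_bigr => f /val_weyl_of_ffun ->.
Qed.

Lemma finite_interlaced (x : weyl N.+1) :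
  finite_set [set y : weyl N | interlaced (val y) (val x)].
Proof.
rewrite -(image_eq (bij_interlaced x)).
exact/finite_image/finite_finset.
Qed.

End interlacing.

(** * The intertwining relation *)

(** A total pairing, so that it can be used under sums over [y]; the default [point] is taken only
    off the interlaced pairs, which the sums exclude. *)
Definition weyl2_of N (y : weyl N) (x : weyl N.+1) : weyl2 N :=
  insubd (point : weyl2 N) (val y, val x).

Lemma val_weyl2_of N (y : weyl N) (x : weyl N.+1) :
  interlaced (val y) (val x) -> val (weyl2_of y x) = (val y, val x).
Proof. by move=> yx; rewrite insubdK. Qed.

Lemma ypart_weyl2_of N (y : weyl N) (x : weyl N.+1) :
  interlaced (val y) (val x) -> ypart (weyl2_of y x) = y.
Proof. by move=> yx; apply/val_inj; rewrite /= val_weyl2_of. Qed.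

Lemma xpart_weyl2_of N (y : weyl N) (x : weyl N.+1) :
  interlaced (val y) (val x) -> xpart (weyl2_of y x) = x.
Proof. by move=> yx; apply/val_inj; rewrite /= val_weyl2_of. Qed.

Lemma interlaced_parts N (q : weyl2 N) :
  interlaced (val (ypart q)) (val (xpart q)).
Proof. exact: (valP q). Qed.

Lemma weyl2_of_parts N (q : weyl2 N) : weyl2_of (ypart q) (xpart q) = q.
Proof.
apply/val_inj; rewrite val_weyl2_of ?interlaced_parts//=.
by case: (val q).
Qed.

Section intertwining.
Context {R : realType} (lam : nat -> R) (K : R).
Hypotheses (lam_gt0 : forall x, 0 < lam x) (lam_le : forall x, `|lam x| <= K).

Lemma hfun_gt0 N (x : weyl N) : 0 < hfun lam x.
Proof.
elim: N x => [x|N IHN x /=]; first exact: ltr01.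
case: ifP => // _.
rewrite (_ : \sum_(y \in _) _ =
  \sum_(y \in [set y : weyl N | interlaced (val y) (val x)])
    ((\prod_i (lam (val y i))^-1) * hfun lam y))//.
have F0 (y : weyl N) : 0 < (\prod_i (lam (val y i))^-1) * hfun lam y.
  by rewrite mulr_gt0// prodr_gt0// => i _; rewrite invr_gt0.
(* The sum is not empty: since the left inequality of interlacing is weak, [y] may copy the first
   [N] entries of [x]. *)
pose y0 : {ffun 'I_N -> nat} := [ffun i => val x (widen_ord (leqnSn N) i)].
have y0x : interlaced y0 (val x).
  by apply/forallP => i; rewrite ffunE leqnn/= weyl_lt_step.
rewrite (@fsbigD1 _ _ _ _ (exist _ y0 (interlaced_is_weyl y0x)))//; last first.
  exact: finite_interlaced.
by rewrite ltr_wpDr// fsumr_ge0// => y _; exact: ltW.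
Qed.

(** For [0 < N], the recursion defines [hfun lam x] as exactly the sum of the numerators. *)
Lemma sum_LDoob N (x : weyl N.+1) : (0 < N)%N ->
  \sum_(y \in [set y : weyl N | interlaced (val y) (val x)]) LDoob lam x y = 1.
Proof.
move=> N0; have := hfun_gt0 x; rewrite /= gtn_eqF// => h0.
rewrite -[RHS](mulVf (lt0r_neq0 h0)) fsbig_distrr; last first.
  exact: finite_interlaced.
apply: eq_fsbigr => y /set_mem/= yx; rewrite /LDoob /= gtn_eqF// yx mulr1.
by rewrite mulrAC mulrC [X in _ * X]mulrC.
Qed.

Lemma sum_Uker N t (x : weyl N.+1) (q : weyl2 N) :
  \sum_(y \in [set y : weyl N | interlaced (val y) (val x)])
     (\prod_i (lam (val y i))^-1) * Uker lam t (weyl2_of y x) q =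
  \det (\matrix_(i < N.+1, j < N.+1)
     ptrans lam t (val x i) (val (xpart q) j)) *
  \prod_i (lam (val (ypart q) i))^-1.
Proof.
have lam0 v : lam v != 0 by rewrite gt_eqF.
set x' := val (xpart q); set y' := val (ypart q).
pose A := blockA lam t (val x) x'; pose B := blockB lam t (val x) y'.
(* A lower row of the determinant as a function of the single entry [v] of [y] that it involves. *)
pose r v : 'rV[R]_(N.+1 + N) := row_mx
  (\row_j (lam v *
    nablap (fun w => nablam (fun u => pcum lam t u w) (x' j)%:Z) v))
  (\row_j ptrans lam t v (y' j)).
pose F (y : {ffun 'I_N -> nat}) := (\prod_i (lam (y i))^-1) *
  \det (col_mx (row_mx A B) (\matrix_(i < N, j < N.+1 + N) r (y i) 0 j)).
transitivity (\sum_(y \in [set y : weyl N | interlaced (val y) (val x)])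
    F (val y)).
  apply: eq_fsbigr => y /set_mem/= yx; congr (_ * _).
  rewrite /Uker val_weyl2_of// (_ : val q = (y', x')); last first.
    exact: surjective_pairing.
  congr (\det _); rewrite /block_mx; congr col_mx; apply/matrixP => i j.
  rewrite [RHS]mxE /r; case: (split_ordP j) => k ->.
    by rewrite !row_mxEl !mxE.
  by rewrite !row_mxEr !mxE.
rewrite fsbig_interlaced /F.
rewrite (eq_bigr (fun f : {ffun 'I_N -> 'I_(val x ord_max)} =>
  (\prod_i (fun v : 'I_(val x ord_max) => (lam v)^-1) (f i)) *
  \det (col_mx (row_mx A B)
    (\matrix_(i, j) (fun v : 'I_(val x ord_max) => r v) (f i) 0 j))));
  last first.
  move=> f _; congr (_ * _).
    by apply: eq_bigr => i _; rewrite ffunE.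
  by congr (\det (col_mx _ _)); apply/matrixP => i j; rewrite !mxE ffunE.
rewrite /interlaced_ffuns (@det_col_mx_sum R 'I_(val x ord_max) _ _ _ _
  (fun v => (lam v)^-1) (fun v => r v)).
(* Multiplication by [E] takes differences of consecutive rows: row [i] minus row [i + 1]. *)
pose E : 'M[R]_(N, N.+1) := \matrix_(i, k)
  ((k == widen_ord (leqnSn N) i)%:R - (k == lift ord0 i)%:R).
pose d : 'rV[R]_N := \row_j (lam (y' j))^-1.
have EM n (M : 'M[R]_(N.+1, n)) i j : (E *m M) i j =
    M (widen_ord (leqnSn N) i) j - M (lift ord0 i) j.
  rewrite mxE; under eq_bigr do rewrite mxE mulrBl.
  rewrite big_split/= sumrN; congr (_ - _).
    rewrite (bigD1 (widen_ord (leqnSn N) i))//= eqxx mul1r big1 ?addr0// => k.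
    by move/negPf => ->; rewrite mul0r.
  rewrite (bigD1 (lift ord0 i))//= eqxx mul1r big1 ?addr0// => k.
  by move/negPf => ->; rewrite mul0r.
rewrite (_ : \matrix_(i, j) _ = row_mx (E *m A) (E *m B + diag_mx d)).
  rewrite -/(block_mx _ _ _ _) det_block_row_op det_diag.
  by congr (_ * _); apply: eq_bigr => i _; rewrite mxE.
have xlt i := ltnW (weyl_lt_step x i).
apply/matrixP => i j; rewrite mxE /r; case: (split_ordP j) => k ->.
  (* Columns of [A]: by [nablam_pcum] the double difference is minus a forward difference of
     [ptrans], and the weight cancels the factor [lam v]. *)
  rewrite row_mxEl EM !mxE.
  rewrite -[RHS]opprK opprB -(@telescope_sum_ord _ (val x ord_max) _ _
    (fun v => ptrans lam t v (x' k)))//; last exact: weyl_le_max.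
  rewrite -sumrN; apply: eq_bigr => v _.
  by rewrite row_mxEl mxE mulKf// /nablap !nablam_pcum opprB opprK addrC.
rewrite row_mxEr [RHS]mxE EM !mxE.
(* Columns of [B]: by [nablap_pcum], the weighted entry [ptrans lam t v (y' k) / lam v] is minus the
   forward difference of [pcum] in [v], divided by [lam (y' k)]. *)
transitivity (- (\sum_(v < val x ord_max |
      (val x (widen_ord (leqnSn N) i) <= v < val x (lift ord0 i))%N)
    (pcum lam t (y' k)%:Z v.+1 - pcum lam t (y' k)%:Z v)) / lam (y' k)).
  rewrite mulNr mulr_suml -sumrN; apply: eq_bigr => v _.
  rewrite row_mxEr mxE; apply: (mulfI (lam0 v)); rewrite mulVKf//.
  apply: (mulfI (lam0 (y' k))).
  have := nablap_pcum lam_le t (y' k) v; rewrite /nablap => h.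
  by rewrite -[LHS]opprK -h; field.
rewrite (@telescope_sum_ord _ _ _ _ (pcum lam t (y' k)%:Z))//; last first.
  exact: weyl_le_max.
(* The indicators in rows [i] and [i + 1] of [B] are those of [i <= k] and [i < k]. They differ only
   at [i = k], which is what the diagonal [d] corrects. *)
have ltik : (lift ord0 i <= k)%N = (i < k)%N by [].
rewrite ltik /=; have [<-|ik] := eqVneq i k.
  by rewrite leqnn ltnn mulr1n mulr1n mulr0n; ring.
have -> : (i <= k)%N = (i < k)%N.
  by rewrite leq_eqVlt -[X in X || _]/(i == k) (negPf ik).
rewrite mulr0n addr0; set c := _%:R; ring.
Qed.

(** This is [sum_Uker] after the Doob transforms: [hfun lam y] cancels in each summand on the left,
    and [hfun lam (xpart q)] cancels on the right. *)
Lemma intertwining N t (x : weyl N.+1) (q : weyl2 N) :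
  \sum_(y \in [set y : weyl N | interlaced (val y) (val x)])
     LDoob lam x y * UDoob lam t (weyl2_of y x) q =
  PDoob lam t x (xpart q) * LDoob lam (xpart q) (ypart q).
Proof.
have h0 M (z : weyl M) : hfun lam z != 0 by rewrite gt_eqF ?hfun_gt0.
rewrite /PDoob /LDoob interlaced_parts.
transitivity (hfun lam (ypart q) / hfun lam x *
  (\det (\matrix_(i < N.+1, j < N.+1)
     ptrans lam t (val x i) (val (xpart q) j)) *
  \prod_i (lam (val (ypart q) i))^-1)); last first.
  move: (h0 _ x) (h0 _ (xpart q)).
  move: (hfun lam x) (hfun lam (xpart q)) => a b a0 b0.
  by rewrite mulr1; field; rewrite a0 b0.
rewrite -sum_Uker fsbig_distrr; last exact: finite_interlaced.
apply: eq_fsbigr => y /set_mem yx.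
have {}yx : interlaced (val y) (val x) by [].
rewrite /UDoob yx mulr1 ypart_weyl2_of//.
move: (h0 _ x) (h0 _ y); move: (hfun lam x) (hfun lam y) => a b a0 b0.
by rewrite /=; field; rewrite a0 b0.
Qed.

End intertwining.

(** * Conditioning on countable partitions *)

Section countable_fibers.
Context {d : measure_display} {Omega : measurableType d} {R : realType}.
Context {S : countType} (W : Omega -> S).
Hypothesis mW : forall x, measurable (W @^-1` [set x]).

Definition fiber (n : nat) : set Omega := [set w | pickle (W w) = n].

Lemma fiberP n : fiber n = set0 \/ exists x, fiber n = W @^-1` [set x].
Proof.
have [[w wn]|F0] := pselect (exists w, fiber n w); [right|left].
  exists (W w); apply/seteqP; split => w' /=.
    by rewrite /fiber/= -wn => /(pcan_inj pickleK).
  by rewrite /fiber/= -wn => ->.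
by rewrite -subset0 => w wn; apply: F0; exists w.
Qed.

Lemma measurable_fiber n : measurable (fiber n).
Proof. by have [->|[x ->]] := fiberP n. Qed.

Lemma trivIset_fiber : trivIset setT fiber.
Proof. by move=> i j _ _ [w [<- <-]]. Qed.

Lemma bigcup_fiber A : \bigcup_n (A `&` fiber n) = A.
Proof.
apply/seteqP; split => [w [n _ []//]|w Aw].
by exists (pickle (W w)).
Qed.

Lemma trivIset_setI_fiber A : trivIset setT (fun n => A `&` fiber n).
Proof. exact/trivIset_setIl/trivIset_fiber. Qed.

Lemma measurable_setI_fiber A n : measurable A -> measurable (A `&` fiber n).
Proof. by move=> mA; apply: measurableI => //; exact: measurable_fiber. Qed.

Lemma measure_fiber (mu : {measure set Omega -> \bar R}) A : measurable A ->
  mu A = (\sum_(n <oo) mu (A `&` fiber n))%E.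
Proof.
move=> mA; rewrite -measure_semi_bigcup.
- by rewrite bigcup_fiber.
- by move=> n; exact: measurable_setI_fiber.
- exact: trivIset_setI_fiber.
- by rewrite bigcup_fiber.
Qed.

Lemma measure_eq_fiberwise (mu : {measure set Omega -> \bar R}) A B (c : R) :
  measurable A -> measurable B ->
  (forall x, mu (A `&` W @^-1` [set x]) =
    c%:E * mu (B `&` W @^-1` [set x]))%E ->
  mu A = (c%:E * mu B)%E.
Proof.
move=> mA mB AB; rewrite (measure_fiber mu mA) (measure_fiber mu mB).
rewrite -nneseriesZl; last by move=> n _; exact: measure_ge0.
apply: eq_eseriesr => n _.
by have [->|[x ->]] := fiberP n; rewrite ?setI0 ?measure0 ?mule0.
Qed.

Variable P : probability Omega R.

Lemma integral_in_fiber (g : S -> R) A x : measurable A ->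
  A `<=` W @^-1` [set x] ->
  (\int[P]_(w in A) (g (W w))%:E = (g x)%:E * P A)%E.
Proof.
move=> mA Ax; rewrite -integral_cst//; apply: eq_integral => w /set_mem.
by move=> /Ax /= ->.
Qed.

(** On an event contained in one level set of [W], the conditional probability is constant. *)
Lemma cond_prob_in_fiber (G : set_system Omega) E (g : S -> R) A x :
  is_cond_prob P G E (g \o W) -> measurable A -> G A ->
  A `<=` W @^-1` [set x] -> P (A `&` E) = ((g x)%:E * P A)%E.
Proof.
by move=> [_ _ gE] mA GA Ax; rewrite -gE// -(integral_in_fiber _ mA Ax).
Qed.

(** A converse: when [W] takes countably many values, the defining integral identity may be checked
    on each level set and summed. *)
Lemma is_cond_prob_fiberwise (G : set_system Omega) E (g : S -> R) :
  G `<=` measurable -> G setT -> measurable E ->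
  (forall V : set S, G (W @^-1` V)) ->
  (forall A x, G A -> P (A `&` W @^-1` [set x] `&` E) =
    ((g x)%:E * P (A `&` W @^-1` [set x]))%E) ->
  is_cond_prob P G E (g \o W).
Proof.
move=> Gm GT mE GW gE.
have mg : measurable_fun setT (g \o W).
  by move=> _ V mV; rewrite setTI; exact: (Gm _ (GW (g @^-1` V))).
(* The sign of [g] is not known, but [g x] times the mass of a level set is a probability, so taking
   absolute values leaves it unchanged. Summing gives the integral [P E], hence integrability. *)
have int_fiber n : (\int[P]_(w in setT `&` fiber n) `|(g (W w))%:E| =
    P (E `&` fiber n))%E.
  rewrite setTI; have [->|[x ->]] := fiberP n.
    by rewrite integral_set0 setI0 measure0.
  rewrite (@integral_in_fiber (fun x => `|g x|) _ x)//.
  have := gE setT x GT; rewrite setTI [E `&` _]setIC => gEx.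
  rewrite -[RHS]gee0_abs ?measure_ge0// gEx.
  by rewrite abseM (gee0_abs (measure_ge0 P _)).
have ig : P.-integrable setT (EFin \o (g \o W)).
  apply/integrableP; split; first exact/measurable_EFinP.
  rewrite -[X in integral _ X](bigcup_fiber setT) ge0_integral_bigcup//.
  - rewrite (eq_eseriesr (fun n _ => int_fiber n)) -measure_fiber//.
    by rewrite (le_lt_trans (probability_le1 _ _))// ltry.
  - by move=> n; exact: measurable_setI_fiber.
  - rewrite bigcup_fiber; apply/measurableT_comp => //.
    exact/measurable_EFinP.
  - exact: trivIset_setI_fiber.
split => // [V mV|A GA]; first exact: (GW (g @^-1` V)).
have mA := Gm _ GA.
rewrite -[X in integral _ X](bigcup_fiber A) integral_bigcup//.
- rewrite (measure_fiber P (measurableI _ _ mA mE)).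
  apply: eq_eseriesr => n _; rewrite setIAC.
  have [->|[x ->]] := fiberP n.
    by rewrite setI0 set0I integral_set0 measure0.
  rewrite (@integral_in_fiber g _ x); last exact: subIsetr.
    exact/esym/gE.
  exact: measurableI.
- exact: trivIset_setI_fiber.
- by move=> n; exact: measurable_setI_fiber.
- by rewrite bigcup_fiber; apply: integrableS ig.
Qed.

End countable_fibers.

(** * Natural filtrations *)

Section natural_filtration.
Context {d d' : measure_display} {Omega : measurableType d} {R : realType}.
Context {S : measurableType d'} (Z : {nonneg R} -> Omega -> S).
Implicit Types s t u : {nonneg R}.

Lemma natural_filtrationT s : natural_filtration Z s setT.
Proof.
by rewrite -(setD0 setT); apply: sigma_algebraCD; exact: sigma_algebra0.
Qed.

Lemma natural_filtrationI s : setI_closed (natural_filtration Z s).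
Proof. by have /sigma_algebraP[//|] := smallest_sigma_algebra setT
  (\bigcup_(u in [set u : {nonneg R} | u%:num <= s%:num]) sigma_rv (Z u)). Qed.

Lemma natural_filtration_preimage u s (V : set S) : u%:num <= s%:num ->
  measurable V -> natural_filtration Z s (Z u @^-1` V).
Proof.
move=> us mV; apply: sub_sigma_algebra; exists u => //.
by exists V => //; rewrite setTI.
Qed.

Lemma natural_filtration_le s t : s%:num <= t%:num ->
  natural_filtration Z s `<=` natural_filtration Z t.
Proof.
move=> st; apply: sub_sigma_algebra2 => A [u us ZA].
by exists u => //; exact: le_trans us st.
Qed.

Lemma natural_filtration_sub (G : set_system Omega) s : sigma_algebra setT G ->
  (forall u (V : set S), u%:num <= s%:num -> measurable V -> G (Z u @^-1` V)) ->
  natural_filtration Z s `<=` G.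
Proof.
move=> sG ZG; apply: smallest_sub => // A [u us [V mV <-]].
by rewrite setTI; exact: ZG.
Qed.

Lemma natural_filtration_measurable s :
  (forall t, measurable_fun setT (Z t)) ->
  natural_filtration Z s `<=` measurable.
Proof.
move=> mZ; apply: natural_filtration_sub => [|u V _ mV].
  exact: sigma_algebra_measurable.
by rewrite -[X in measurable X]setTI; exact: mZ.
Qed.

(* Finite intersections of events about a process, listed in order of time:
   unlike unordered ones, these can be handled by conditioning on the last
   time. *)
Inductive cylinder : {nonneg R} -> set Omega -> Prop :=
| cylinderT s : cylinder s setT
| cylinderI s t A (V : set S) : s%:num <= t%:num -> measurable V ->
    cylinder s A -> cylinder t (A `&` Z s @^-1` V).

Lemma cylinder_preimage u t A (V : set S) : u%:num <= t%:num -> measurable V ->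
  cylinder t A -> cylinder t (A `&` Z u @^-1` V).
Proof.
move=> + mV cA; elim: cA u => {t A} [t|s t A W st mW cA IHA] u ut.
  by apply: cylinderI => //; exact: cylinderT.
(* Insertion into a sorted list: an earlier time goes into the tail by induction, a later one goes
   on top. *)
have [us|/ltW su] := leP u%:num s%:num.
  by rewrite setIAC; apply: cylinderI => //; exact: IHA.
by apply: cylinderI => //; exact: cylinderI.
Qed.

Lemma cylinder_setI s t A B : s%:num <= t%:num ->
  cylinder t A -> cylinder s B -> cylinder t (A `&` B).
Proof.
move=> + cA cB; elim: cB => {s B} [s|u s B V us mV cB IHB] st.
  by rewrite setIT.
rewrite setIA; apply: cylinder_preimage => //; first exact: le_trans us st.
by apply: IHB; exact: le_trans us st.
Qed.

Lemma natural_filtration_cylinder s :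
  natural_filtration Z s `<=` <<s cylinder s >>.
Proof.
apply: natural_filtration_sub => [|u V us mV].
  exact: smallest_sigma_algebra.
apply: sub_sigma_algebra; rewrite -[X in cylinder _ X]setTI.
by apply: cylinderI => //; exact: cylinderT.
Qed.

End natural_filtration.

(** * The projection on the upper particles *)

Lemma LDoob_ge0 (R : realType) (lam : nat -> R) N (x : weyl N.+1) (y : weyl N) :
  (forall v, 0 < lam v) -> 0 <= LDoob lam x y.
Proof.
move=> lam_gt0; rewrite /LDoob !mulr_ge0 ?invr_ge0 ?(ltW (hfun_gt0 _ _))//.
by apply: prodr_ge0 => i _; rewrite invr_ge0 ltW.
Qed.

Lemma weyl2_of_inj N (x : weyl N.+1) (y1 y2 : weyl N) :
  interlaced (val y1) (val x) -> interlaced (val y2) (val x) ->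
  weyl2_of y1 x = weyl2_of y2 x -> y1 = y2.
Proof.
by move=> y1x y2x /(congr1 (@ypart N)); rewrite !ypart_weyl2_of.
Qed.

Lemma measure_xpart_fiber (d : measure_display) (Omega : measurableType d)
    (R : realType) (mu : {measure set Omega -> \bar R}) N
    (Z : Omega -> weyl2 N) (A : set Omega) x :
  (forall q, measurable (Z @^-1` [set q])) -> measurable A ->
  (mu (A `&` Z @^-1` (@xpart N @^-1` [set x])) =
   \sum_(y \in [set y : weyl N | interlaced (val y) (val x)])
     mu (A `&` Z @^-1` [set weyl2_of y x]))%E.
Proof.
move=> mZ mA; rewrite -measure_fin_bigcup.
- congr (mu _); apply/seteqP; split => [w [Aw /= Zx]|w [y /= yx [Aw /= Zy]]].
    exists (ypart (Z w)); first by rewrite /= -Zx; exact: interlaced_parts.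
    by split => //=; rewrite -Zx weyl2_of_parts.
  by split => //=; rewrite Zy xpart_weyl2_of.
- exact: finite_interlaced.
- move=> y1 y2 /= y1x y2x [w [[_ /= Z1] [_ /= Z2]]].
  by apply: (weyl2_of_inj y1x y2x); rewrite -Z1 -Z2.
- by move=> y _; exact: measurableI.
Qed.

Section projection.
Context {R : realType} (lam : nat -> R) (K : R).
Hypotheses (lam_gt0 : forall x, 0 < lam x) (lam_le : forall x, `|lam x| <= K).
Context {N : nat} (N_gt0 : (0 < N)%N).
Context {d : measure_display} {Omega : measurableType d}.
Variables (P : probability Omega R) (Z : {nonneg R} -> Omega -> weyl2 N).
Hypothesis Z_markov : markov_process P (UDoob lam (N:=N)) Z.
Implicit Types s t : {nonneg R}.

Let X t := @xpart N \o Z t.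

(** The conditional law of [Z s] given [A] and [X s], with the denominator multiplied out so that
    null events need no exception. *)
Definition LDoob_fiber_law s (A : set Omega) := forall q : weyl2 N,
  P (A `&` Z s @^-1` [set q]) =
  ((LDoob lam (xpart q) (ypart q))%:E * P (A `&` X s @^-1` [set xpart q]))%E.

Lemma measurable_Z_preimage t (V : set (weyl2 N)) : measurable (Z t @^-1` V).
Proof. by rewrite -[X in measurable X]setTI; exact: Z_markov.1. Qed.

Lemma measurable_X_preimage t (V : set (weyl N.+1)) : measurable (X t @^-1` V).
Proof. exact: (measurable_Z_preimage t (@xpart N @^-1` V)). Qed.

Let FZ_measurable s : natural_filtration Z s `<=` measurable.
Proof. exact/natural_filtration_measurable/Z_markov.1. Qed.

Lemma natural_filtration_proj s :
  natural_filtration X s `<=` natural_filtration Z s.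
Proof.
apply: natural_filtration_sub => [|u V us _].
  exact: smallest_sigma_algebra.
exact: (@natural_filtration_preimage _ _ _ _ _ Z u s (@xpart N @^-1` V)).
Qed.

(** Split by the value of the lower particles at time [s]. The Markov property of [Z] produces
    [UDoob], the law of the fiber produces [LDoob], and the intertwining sums their product. *)
Lemma joint_transition s t A x q : s%:num <= t%:num ->
  natural_filtration Z s A -> LDoob_fiber_law s A ->
  P (A `&` X s @^-1` [set x] `&` Z t @^-1` [set q]) =
  ((PDoob lam (t%:num - s%:num) x (xpart q) *
    LDoob lam (xpart q) (ypart q))%:E * P (A `&` X s @^-1` [set x]))%E.
Proof.
move=> st FA LA; have mA := FZ_measurable FA.
have mB : measurable (A `&` Z t @^-1` [set q]).
  by apply: measurableI => //; exact: measurable_Z_preimage.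
rewrite setIAC measure_xpart_fiber//; last first.
  by move=> q'; exact: measurable_Z_preimage.
rewrite -[X in (_ * P X)%E]/(A `&` X s @^-1` [set x]).
have : P (A `&` X s @^-1` [set x]) \is a fin_num.
  apply: fin_num_measure; apply: measurableI => //.
  exact: measurable_X_preimage.
move=> /fineK; set p := fine _ => pE.
rewrite -pE -EFinM -(intertwining lam_gt0 lam_le) mulrC.
rewrite fsbig_distrr; last first.
  exact: finite_interlaced.
rewrite -fsumEFin; last exact: finite_interlaced.
apply: eq_fsbigr => y /set_mem yx; have {}yx : interlaced (val y) (val x) by [].
rewrite setIAC.
have mAy : measurable (A `&` Z s @^-1` [set weyl2_of y x]).
  by apply: measurableI => //; exact: measurable_Z_preimage.
have FAy : natural_filtration Z s (A `&` Z s @^-1` [set weyl2_of y x]).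
  by apply: natural_filtrationI => //; exact: natural_filtration_preimage.
rewrite [LHS](@cond_prob_in_fiber _ _ _ _ (Z s) P _ _
  (fun p => UDoob lam (t%:num - s%:num) p q) _ (weyl2_of y x)
  (Z_markov.2 _ _ st q) mAy FAy (@subIsetr _ _ _)).
rewrite LA ypart_weyl2_of// xpart_weyl2_of// -pE -!EFinM.
by rewrite mulrA mulrC [in RHS](mulrC (LDoob _ _ _)).
Qed.

(** Sum [joint_transition] over the lower particles at time [t], where [LDoob lam x'] has total mass
    1. *)
Lemma X_transition s t A x x' : s%:num <= t%:num ->
  natural_filtration Z s A -> LDoob_fiber_law s A ->
  P (A `&` X s @^-1` [set x] `&` X t @^-1` [set x']) =
  ((PDoob lam (t%:num - s%:num) x x')%:E * P (A `&` X s @^-1` [set x]))%E.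
Proof.
move=> st FA LA; have mA := FZ_measurable FA.
have mB : measurable (A `&` X s @^-1` [set x]).
  by apply: measurableI => //; exact: measurable_X_preimage.
rewrite measure_xpart_fiber//; last first.
  by move=> q'; exact: measurable_Z_preimage.
have /fineK := @fin_num_measure _ _ _ P _ mB; set p := fine _ => pE.
transitivity (\sum_(y \in [set y : weyl N | interlaced (val y) (val x')])
  (PDoob lam (t%:num - s%:num) x x' * p * LDoob lam x' y)%:E)%E.
  apply: eq_fsbigr => y /set_mem yx.
  have {}yx : interlaced (val y) (val x') by [].
  rewrite [LHS]joint_transition// xpart_weyl2_of// ypart_weyl2_of// -pE -EFinM.
  by rewrite mulrAC.
rewrite fsumEFin; last exact: finite_interlaced.
rewrite -fsbig_distrr; last exact: finite_interlaced.
by rewrite /= (sum_LDoob lam_gt0)// mulr1 EFinM pE.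
Qed.

(** For each value [x] of [X s], the joint transition is the transition of [X] times a factor
    [LDoob] that does not depend on [x]; sum over [x]. *)
Lemma fiber_law_le s t A : s%:num <= t%:num ->
  natural_filtration Z s A -> LDoob_fiber_law s A -> LDoob_fiber_law t A.
Proof.
move=> st FA LA q; have mA := FZ_measurable FA.
apply: (measure_eq_fiberwise (W := X s)).
- by move=> x; exact: measurable_X_preimage.
- by apply: measurableI => //; exact: measurable_Z_preimage.
- by apply: measurableI => //; exact: measurable_X_preimage.
- move=> x; rewrite setIAC [LHS]joint_transition// [in RHS]setIAC.
  rewrite mulrC EFinM -muleA; congr (_ * _)%E.
  exact/esym/X_transition.
Qed.

Lemma fiber_law_setI s A (V : set (weyl N.+1)) :
  LDoob_fiber_law s A -> LDoob_fiber_law s (A `&` X s @^-1` V).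
Proof.
move=> LA q; have [Vq|nVq] := pselect (V (xpart q)).
  rewrite -!setIA [X in (A `&` X)](_ : _ = Z s @^-1` [set q]); last first.
    by apply/seteqP; split => [w []//|w /= Zq]; split => //=; rewrite /X/= Zq.
  rewrite [X in (_ * P (A `&` X))%E](_ : _ = X s @^-1` [set xpart q])//.
  by apply/seteqP; split => [w []//|w /= Xq]; split => //=; rewrite Xq.
rewrite [X in P X](_ : _ = set0); last first.
  by rewrite -subset0 => w [[_ /= +] /= Zq]; rewrite /X/= Zq.
rewrite [X in (_ * P X)%E](_ : _ = set0).
  by rewrite measure0 mule0.
by rewrite -subset0 => w [[_ /= +] /= Xq]; rewrite Xq.
Qed.

Hypothesis Z_init : LDoob_fiber_law 0%:nng setT.

Lemma fiber_law_cylinder s A : cylinder X s A ->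
  natural_filtration Z s A /\ LDoob_fiber_law s A.
Proof.
elim=> {s A} [s|s t A V st _ _ [FA LA]].
  split; first exact: natural_filtrationT.
  (* The initial law gives the property for the sure event at time 0, and it is carried to time
     [s]. *)
  apply: (fiber_law_le _ _ Z_init); last exact: natural_filtrationT.
  by rewrite -[leLHS]/(0 : R).
have FAV : natural_filtration Z s (A `&` X s @^-1` V).
  apply: natural_filtrationI => //.
  exact: (@natural_filtration_preimage _ _ _ _ _ Z s s (@xpart N @^-1` V)).
split; first exact: natural_filtration_le FAV.
by apply: fiber_law_le FAV _ => //; exact: fiber_law_setI.
Qed.

Lemma fiber_law_natural_filtration s A :
  natural_filtration X s A -> LDoob_fiber_law s A.
Proof.
move=> FA q.
have mZq := measurable_Z_preimage s [set q].
have mXq := measurable_X_preimage s [set xpart q].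
(* For fixed [q], both sides are finite measures in [A], the right one scaled by the nonnegative
   number [L]. They agree on the cylinders, which are stable under intersection and include
   [setT]. *)
pose L := NngNum (LDoob_ge0 (xpart q) (ypart q) lam_gt0).
apply: (@g_sigma_algebra_measure_unique _ _ _ (cylinder X s) _ (fun=> setT) _ _
  (mrestr P mZq) (mscale L (mrestr P mXq))) => //.
- by move=> B /fiber_law_cylinder[/FZ_measurable].
- by move=> _; exact: cylinderT.
- by rewrite bigcup_const.
- by move=> B C cB cC; exact: cylinder_setI cB cC.
- by move=> B /fiber_law_cylinder[_]; exact.
- move=> _; rewrite /mrestr (le_lt_trans (probability_le1 _ _))// ?ltry//.
  exact: measurableI.
- exact: natural_filtration_cylinder.
Qed.

Lemma markov_process_proj : markov_process P (PDoob lam (N:=N.+1)) X.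
Proof.
split=> [t _ V _|s t st x'].
  by rewrite setTI; exact: measurable_X_preimage.
apply: (@is_cond_prob_fiberwise _ _ _ _ (X s) _ _ _ _
  (fun x => PDoob lam (t%:num - s%:num) x x')).
- by move=> x; exact: measurable_X_preimage.
- by move=> A /natural_filtration_proj/FZ_measurable.
- exact: natural_filtrationT.
- exact: measurable_X_preimage.
- by move=> V; exact: natural_filtration_preimage.
- move=> A x FA; apply: X_transition => //.
    exact: natural_filtration_proj.
  exact: fiber_law_natural_filtration.
Qed.

Lemma cond_law_fiber t : is_cond_law P (sigma_rv (X t)) (Z t)
  (fun w => LDoob2 lam (X t w)).
Proof.
have sub A : sigma_rv (X t) A -> natural_filtration X t A.
  by move=> [V mV <-]; rewrite setTI; exact: natural_filtration_preimage.
move=> q; apply: (@is_cond_prob_fiberwise _ _ _ _ (X t) _ _ _ _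
  (fun x => LDoob2 lam x q)).
- by move=> x; exact: measurable_X_preimage.
- by move=> A /sub/natural_filtration_proj/FZ_measurable.
- by exists setT => //; rewrite setTI preimage_setT.
- exact: measurable_Z_preimage.
- by move=> V; exists V => //; rewrite setTI.
- move=> A x /sub/fiber_law_natural_filtration LA; rewrite /LDoob2.
  (* If [x] is not the upper part of [q], the event is empty and [LDoob2] vanishes. *)
  have [<-|qx] := eqVneq (xpart q) x.
    rewrite mul1r -LA -setIA; congr (P (_ `&` _)).
    by apply/seteqP; split => [w []//|w /= Zq]; split => //; rewrite /X/= Zq.
  rewrite mul0r mul0e [X in P X](_ : _ = set0) ?measure0//.
  rewrite -subset0 => w [[_ /= Xx] /= Zq]; move/eqP: qx; apply.
  by rewrite -Xx /X/= Zq.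
Qed.

End projection.

Lemma law_eq_point_masses (d : measure_display) (Omega : measurableType d)
    (R : realType) (mu : {measure set Omega -> \bar R}) N
    (M : {measure set (weyl N) -> \bar R}) (W : Omega -> weyl N) :
  (forall V, measurable (W @^-1` V)) ->
  (forall x, mu (W @^-1` [set x]) = M [set x]) ->
  forall B, mu (W @^-1` B) = M B.
Proof.
move=> mW WM B.
rewrite (measure_fiber (W := W) (fun x => mW [set x]) mu (mW B)).
rewrite (measure_fiber (W := @id (weyl N)) (fun _ => I) M (I : measurable B)).
apply: eq_eseriesr => n _.
rewrite -[X in mu X]/(W @^-1` (B `&` fiber (@id (weyl N)) n)).
have [->|[x ->]] := fiberP (@id (weyl N)) n.
  by rewrite setI0 preimage_set0 !measure0.
have [Bx|nBx] := pselect (B x).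
  by rewrite setIidr ?WM// => _ /= ->.
rewrite (_ : _ `&` _ = set0) ?preimage_set0 ?measure0//.
by rewrite -subset0 => y [+ /= yx]; rewrite yx.
Qed.

Theorem theorem2p20 (R : realType) (lam : nat -> R)
    (lam_gt0 : forall x, 0 < lam x)
    (lam_inf : 0 < inf (range lam))
    (lam_sup : has_ubound (range lam))
    (N : nat) (N_ge1 : (1 <= N)%N)
    (d : measure_display) (Omega : measurableType d) (P : probability Omega R)
    (Z : {nonneg R} -> Omega -> weyl2 N)
    (Z_markov : markov_process P (UDoob lam (N:=N)) Z)
    (M : probability (weyl N.+1) R)
    (Z_init : forall q : weyl2 N,
      P (Z 0%:nng @^-1` [set q]) =
      (M [set xpart q] * (LDoob lam (xpart q) (ypart q))%:E)%E) :
  let X := fun t => @xpart N \o Z t in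
  [/\ markov_process P (PDoob lam (N:=N.+1)) X,
      forall B : set (weyl N.+1), P (X 0%:nng @^-1` B) = M B &
      forall T : {nonneg R},
        is_cond_law P (sigma_rv (X T)) (Z T)
          (fun w => LDoob2 lam (X T w))].
Proof.
move=> X.
have [K lamK] : exists K, forall x, `|lam x| <= K.
  have [K ubK] := lam_sup; exists K => x.
  by rewrite gtr0_norm//; apply: ubK; exists x.
have mZ := measurable_Z_preimage Z_markov 0%:nng.
(* Sum the initial density over the lower particles; [LDoob lam x] has total mass 1. *)
have X_init x : P (X 0%:nng @^-1` [set x]) = M [set x].
  rewrite -(setTI (_ @^-1` _)) measure_xpart_fiber//.
  have /fineK := @fin_num_measure _ _ _ M [set x] I; set m := fine _ => mE.
  transitivity (\sum_(y \in [set y : weyl N | interlaced (val y) (val x)])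
      (m * LDoob lam x y)%:E)%E.
    apply: eq_fsbigr => y /set_mem yx; rewrite setTI.
    have {}yx : interlaced (val y) (val x) by [].
    by rewrite [LHS]Z_init xpart_weyl2_of// ypart_weyl2_of// -mE.
  rewrite fsumEFin; last exact: finite_interlaced.
  rewrite -fsbig_distrr; last exact: finite_interlaced.
  by rewrite /= (sum_LDoob lam_gt0)// mulr1 mE.
have Z0 : LDoob_fiber_law lam P Z 0%:nng setT.
  by move=> q; rewrite !setTI Z_init -X_init muleC.
split.
- exact: (markov_process_proj lam_gt0 lamK N_ge1 Z_markov Z0).
- apply: law_eq_point_masses => // V.
  exact: measurable_X_preimage Z_markov _ V.
- exact: (cond_law_fiber lam_gt0 lamK N_ge1 Z_markov Z0).
Qed.
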